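(* Let $(R_1,\mathcal L_1)$ and $(R_2,\mathcal L_2)$ be sets with a countable language. Suppose that Hilbert's tenth problem exists over $(R_1,\mathcal L_1)$ and over $(R_2,\mathcal L_2)$. If Hilbert's tenth problem over $(R_2,\mathcal L_2)$ has a positive answer and $d:R_1\to R_2$ is an effective Diophantine map, then Hilbert's tenth problem over $(R_1,\mathcal L_1)$ has a positive answer.
   Context: $\mathbb N=\mathbb Z_{\ge0}$. A ''set with a language'' $(R,\mathcal L)$ is a set $R$ together with a language $\mathcal L$ (constants, functions, relations) with an interpretation in $R$; every language contains a constant $0$ and equality. Terms are built from constants and variables using functions of $\mathcal L$; basic formulas have the form $(t_1,\ldots,t_k)\in R'$ with $R'\in\mathcal L$ a $k$-ary relation (possibly equality) and $t_i$ terms. $S\subset R^k$ is Diophantine if $S=\{\vec x\in R^k\mid\exists\vec y\in R^l\ (f_1\wedge\cdots\wedge f_r)\}$ for some basic formulas $f_i$. $d:R_1\to R_2$ is a Diophantine map if the coordinatewise image $d(S)\subset R_2^k$ is Diophantine for all $k$ and all Diophantine $S\subset R_1^k$. Existence of Hilbert's tenth problem. $S_c(\mathcal L)$ is the set of constants of $\mathcal L$ and $S_c'(\mathcal L)=\{x\in R\mid\{x\}\text{ is Diophantine}\}$. A recursive ring is a ring with a recursive representation, i.e. an injection $j$ into $\mathbb N$ with recursive image for which addition and multiplication are recursive. A recursive ring $R_0$ with $S_c(\mathcal L)\subset R_0\subset S_c'(\mathcal L)$ is compatible with $(R,\mathcal L)$ if, for the language $\mathcal L'$ on $R_0$ having each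 constant $c\in\mathcal L$, the relation $S_f\cap R_0^{r+1}$ for each $r$-ary function $f\in\mathcal L$ (with $S_f=\{(\vec x,f(\vec x))\mid\vec x\in R^r\}$) and $S\cap R_0^r$ for each $r$-ary relation $S\in\mathcal L$, one has $S_c'(\mathcal L')=R_0$ and all relations of $\mathcal L'$ are recursive in $R_0$. Hilbert's tenth problem exists over $(R,\mathcal L)$ if $\mathcal L$ is countable and a compatible recursive ring $R_0$ with $S_c(\mathcal L)\subset R_0\subset S_c'(\mathcal L)$ exists. Coding. Fix such a ring $R_i'$ with representation $j_i$ for each $(R_i,\mathcal L_i)$; the same choice is used in all notions below. Number the constants and functions of $\mathcal L_i$ injectively by $\mathrm{num}_{\mathcal L_i}$; put $\mathrm{sym}(l)=2^{\mathrm{num}_{\mathcal L_i}(l)}$ for constants and functions $l$, $\mathrm{sym}(x_n)=3^n$ for variables $x_n$, $\mathrm{sym}(r)=5^{j_i(r)}$ for $r\in R_i'$ (indices chosen so that different symbols get different codes). An $\mathcal L_i$-term (elements of $R_i'$ may occur as constants) written in bracket-free prefix form as a string $s_1\cdots s_n$ gets number $J_i(s_1\cdots s_n)=\prod_m p_m^{\mathrm{sym}(s_m)}$, $p_m$ the $m$-th prime. The relations of $\mathcal L_i$ (including equality) are numbered by natural numbers, and a finite system $(t_{11},\ldots)\in S_{i_1},\ldots,(t_{l1},\ldots)\in S_{i_l}$ is coded by the tuple $(l,i_1,J_i(t_{11}),\ldots,i_l,J_i(t_{l1}),\ldots)\in\bigcup_{n\ge0}\mathbb N^n$. Positive answer.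 Hilbert's tenth problem over $(R_i,\mathcal L_i)$ has a positive answer if there is a recursive function $f:\bigcup_{n\ge0}\mathbb N^n\to\{0,1\}$ whose value on the code of a system is $1$ if and only if the system has a solution over $R_i$. Effective. A Diophantine map $d:R_1\to R_2$ is effective if there is a recursive function $D:\bigcup_{n\ge0}\mathbb N^n\to\bigcup_{n\ge0}\mathbb N^n$ that sends the code of every system $T$ in $\mathcal L_1$ (in variables $\vec x$) to the code of a system $D(T)$ in $\mathcal L_2$ (in variables $(\vec z,\vec y)$, $\vec z$ of the same length as $\vec x$) such that: (i) if $\vec x$ is a solution of $T$ over $R_1$, there is $\vec y$ such that $(d(\vec x),\vec y)$ is a solution of $D(T)$ over $R_2$; (ii) if $(\vec z,\vec y)$ is a solution of $D(T)$ over $R_2$, there is a solution $\vec x$ of $T$ with $\vec z=d(\vec x)$. *)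

(* Defs.v *)
From mathcomp Require Import all_boot all_algebra.
From Stdlib Require List.

Set Implicit Arguments.
Unset Strict Implicit.
Unset Printing Implicit Defensive.

Import GRing.Theory.

(** * Recursive functions *)

(* The class of total recursive functions nat^k -> nat: minimization is only
   applied to regular functions, so that no partial function is needed. In
   recursive_prim the recursion variable is the first argument. *)
Inductive recursive : forall k, (k.-tuple nat -> nat) -> Prop :=
| recursive_zero k : recursive (fun _ : k.-tuple nat => 0)
| recursive_succ : recursive (fun v : 1.-tuple nat => (thead v).+1)
| recursive_proj k (i : 'I_k) : recursive (fun v : k.-tuple nat => tnth v i)
| recursive_comp k m (g : m.-tuple nat -> nat)
    (h : 'I_m -> k.-tuple nat -> nat) :
    recursive g -> (forall i, recursive (h i)) ->
    recursive (fun v => g [tuple h i v | i < m])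
| recursive_prim k (g : k.-tuple nat -> nat) (h : k.+2.-tuple nat -> nat) :
    recursive g -> recursive h ->
    recursive (fun v : k.+1.-tuple nat =>
      nat_rect (fun _ => nat) (g (behead_tuple v))
        (fun n r => h (cons_tuple n (cons_tuple r (behead_tuple v)))) (thead v))
| recursive_min k (g : k.+1.-tuple nat -> nat) (f : k.-tuple nat -> nat) :
    recursive g ->
    (forall v, g (cons_tuple (f v) v) = 0) ->
    (forall v m, m < f v -> g (cons_tuple m v) <> 0) ->
    recursive f
| recursive_ext k (f g : k.-tuple nat -> nat) :
    recursive f -> f =1 g -> recursive g.

Definition recursive_set k (S : k.-tuple nat -> Prop) : Prop :=
  exists chi : k.-tuple nat -> bool,
    recursive (fun v => nat_of_bool (chi v)) /\ forall v, chi v <-> S v.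

(* The union of the nat^n, n >= 0, is seq nat; recursiveness there is meant
   through the effective bijection CodeSeq.code : seq nat -> nat, whose inverse
   is CodeSeq.decode. *)
Definition recursive_seq_bool (f : seq nat -> bool) : Prop :=
  recursive (fun v : 1.-tuple nat => nat_of_bool (f (CodeSeq.decode (thead v)))).

Definition recursive_seq (D : seq nat -> seq nat) : Prop :=
  recursive (fun v : 1.-tuple nat =>
    CodeSeq.code (D (CodeSeq.decode (thead v)))).

(** * Sets with a language *)

(* Equality belongs to every language: the relation symbols are
   [option (rel L)], where [None] is equality (see [relsym]). *)
Record language (R : Type) := Language {
  cst : Type;
  fn : Type;
  rel : Type;
  fn_ar : fn -> nat;
  rel_ar : rel -> nat;
  cst_val : cst -> R;
  fn_val : forall f : fn, (fn_ar f).-tuple R -> R;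
  rel_val : forall r : rel, (rel_ar r).-tuple R -> Prop;
  cst0 : cst
}.

Definition countable (T : Type) : Prop := exists f : T -> nat, injective f.

Definition countable_language R (L : language R) : Prop :=
  [/\ countable (cst L), countable (fn L) & countable (rel L)].

Section Syntax.
Variables (R : Type) (L : language R).

Definition relsym : Type := option (rel L).

Definition relsym_ar (r : relsym) : nat :=
  if r is Some r' then rel_ar r' else 2.

Definition relsym_val (r : relsym) : (relsym_ar r).-tuple R -> Prop :=
  match r with
  | Some r' => @rel_val R L r'
  | None => fun v : 2.-tuple R => tnth v ord0 = tnth v ord_max
  end.

(* Terms in n variables. *)
Inductive term (n : nat) : Type :=
| Var (i : 'I_n)
| Cst (c : cst L)
| Fn (f : fn L) (args : 'I_(fn_ar f) -> term n).

Record formula (n : nat) := Formula {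
  f_rel : relsym;
  f_args : 'I_(relsym_ar f_rel) -> term n
}.

Definition system (n : nat) : Type := seq (formula n).

Fixpoint eval n (x : n.-tuple R) (t : term n) : R :=
  match t with
  | Var i => tnth x i
  | Cst c => cst_val c
  | Fn f args => fn_val [tuple eval x (args i) | i < fn_ar f]
  end.

Definition holds n (x : n.-tuple R) (F : formula n) : Prop :=
  relsym_val [tuple eval x (f_args i) | i < relsym_ar (f_rel F)].

Definition solution n (T : system n) (x : n.-tuple R) : Prop :=
  List.Forall (holds x) T.

Fixpoint occurs_term n (i : 'I_n) (t : term n) : Prop :=
  match t with
  | Var j => j = i
  | Cst _ => False
  | Fn f args => exists k, occurs_term i (args k)
  end.

Definition occurs n (i : 'I_n) (T : system n) : Prop :=
  List.Exists (fun F : formula n => exists k, occurs_term i (@f_args n F k)) T.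

(* n is the largest (1-based) index of a variable of T, or 0 if there is none *)
Definition exact_vars n (T : system n) : Prop :=
  forall i : 'I_n, i.+1 = n -> occurs i T.

(** * Diophantine sets and maps *)

Definition diophantine k (S : k.-tuple R -> Prop) : Prop :=
  exists (l : nat) (T : system (k + l)),
    forall x : k.-tuple R,
      S x <-> exists y : l.-tuple R, solution T (cat_tuple x y).

Definition diophantine_point (x : R) : Prop :=
  diophantine (fun v : 1.-tuple R => thead v = x).

End Syntax.

Definition diophantine_map R1 R2 (L1 : language R1) (L2 : language R2)
    (d : R1 -> R2) : Prop :=
  forall k (S : k.-tuple R1 -> Prop), diophantine L1 S ->
    diophantine L2 (fun z : k.-tuple R2 => exists2 x, S x & z = map_tuple d x).

(** * Existence of Hilbert's tenth problem *)

Definition recursive_rel (A : Type) (j : A -> nat) k (S : k.-tuple A -> Prop) :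
    Prop :=
  recursive_set (fun v : k.-tuple nat => exists2 x, S x & v = map_tuple j x).

Definition recursive_op2 (A : Type) (j : A -> nat) (op : A -> A -> A) : Prop :=
  exists g : 2.-tuple nat -> nat,
    recursive g /\ forall a b, g [tuple j a; j b] = j (op a b).

Record recursive_ring := RecursiveRing {
  rr_sort :> pzRingType;
  rr_rep : rr_sort -> nat;
  rr_rep_inj : injective rr_rep;
  rr_rep_image : recursive_rel rr_rep (fun _ : 1.-tuple rr_sort => True);
  rr_rep_add : recursive_op2 rr_rep +%R;
  rr_rep_mul : recursive_op2 rr_rep *%R
}.

Definition graph R (L : language R) (f : fn L) : (fn_ar f).+1.-tuple R -> Prop :=
  fun v => exists x : (fn_ar f).-tuple R, v = rcons_tuple x (fn_val x).

Section Restriction.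
Variables (R : Type) (L : language R) (A : Type) (emb : A -> R).
Variable cstA : cst L -> A.

Definition restr_ar (s : fn L + rel L) : nat :=
  match s with inl f => (fn_ar f).+1 | inr r => rel_ar r end.

Definition restr_val (s : fn L + rel L) : (restr_ar s).-tuple A -> Prop :=
  match s with
  | inl f => fun v => graph (map_tuple emb v)
  | inr r => fun v => rel_val (map_tuple emb v)
  end.

(* The language induced on the subset of R that is the image of emb; a function
   becomes the relation given by its graph, and equality is kept as [None]. *)
Definition restr_language : language A :=
  @Language A (cst L) void (fn L + rel L)%type (fun _ => 0) restr_ar cstA
    (fun f : void => match f with end) restr_val (cst0 L).

End Restriction.

(* The subset R_0 of R is given as a ring together with an injection
   [cr_emb] into R: the ring structure is only carried by the subset, as R itself
   has none. The inclusions S_c(L) c R_0 c S_c'(L) are [cr_cstE] and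
   [cr_diophantine]. *)
Record compatible_ring R (L : language R) := CompatibleRing {
  cr_ring :> recursive_ring;
  cr_emb : cr_ring -> R;
  cr_emb_inj : injective cr_emb;
  cr_cst : cst L -> cr_ring;
  cr_cstE : forall c, cr_emb (cr_cst c) = cst_val c;
  cr_diophantine : forall a, diophantine_point L (cr_emb a);
  cr_restr_diophantine :
    forall a : cr_ring, diophantine_point (restr_language cr_emb cr_cst) a;
  cr_restr_recursive :
    forall r : relsym (restr_language cr_emb cr_cst),
      recursive_rel (@rr_rep cr_ring) (@relsym_val _ _ r)
}.

Definition H10_exists R (L : language R) : Prop :=
  countable_language L /\ inhabited (compatible_ring L).

(** * Coding of systems *)

Lemma ex_next_prime m : exists p, (m < p) && prime p.
Proof. by have [p lt_mp p_pr] := prime_above m; exists p; rewrite lt_mp. Qed.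

Definition next_prime (m : nat) : nat := ex_minn (ex_next_prime m).

(* nth_prime 0 = 2, nth_prime 1 = 3, ... *)
Definition nth_prime (m : nat) : nat := iter m.+1 next_prime 0.

Definition param_language R (L : language R) (A : Type) (emb : A -> R) :
    language R :=
  @Language R (cst L + A)%type (fn L) (rel L) (@fn_ar R L) (@rel_ar R L)
    (fun c => match c with inl c' => cst_val c' | inr a => emb a end)
    (@fn_val R L) (@rel_val R L) (inl (cst0 L)).

(* The systems to which Hilbert's tenth problem applies: elements of the chosen
   ring R_0 may occur as constants. *)
Definition psystem R (L : language R) (A : compatible_ring L) (n : nat) : Type :=
  system (param_language L (@cr_emb R L A)) n.

Inductive symbol R (L : language R) (A : Type) : Type :=
| SymCst (c : cst L)
| SymFn (f : fn L)
| SymVar (n : nat)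
| SymElt (a : A).
Arguments SymCst {R L A} c.
Arguments SymFn {R L A} f.
Arguments SymVar {R L A} n.
Arguments SymElt {R L A} a.

(* Variables are numbered from 1: SymVar n is x_(n+1), and 3 ^ 0 is not used. *)
Definition sym R (L : language R) (A : compatible_ring L)
    (num : cst L + fn L -> nat) (s : symbol L A) : nat :=
  match s with
  | SymCst c => 2 ^ num (inl c)
  | SymFn f => 2 ^ num (inr f)
  | SymVar n => 3 ^ n.+1
  | SymElt a => 5 ^ rr_rep a
  end.

(* cd_sym_inj excludes the clash 2 ^ 0 = 5 ^ 0. *)
Record coding R (L : language R) (A : compatible_ring L) := Coding {
  cd_num : cst L + fn L -> nat;
  cd_num_inj : injective cd_num;
  cd_sym_inj : injective (@sym R L A cd_num);
  cd_rel : relsym L -> nat;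
  cd_rel_inj : injective cd_rel
}.

Section Code.
Variables (R : Type) (L : language R) (A : compatible_ring L) (C : coding A).

Fixpoint prefix_form n (t : term (param_language L (@cr_emb R L A)) n) :
    seq (symbol L A) :=
  match t with
  | Var i => [:: SymVar i]
  | Cst (inl c) => [:: SymCst c]
  | Cst (inr a) => [:: SymElt a]
  | Fn f args =>
      @SymFn R L A f :: flatten [seq prefix_form (args i) | i <- enum 'I_(fn_ar f)]
  end.

Definition code_string (s : seq (symbol L A)) : nat :=
  \prod_(m < size s) nth_prime m ^ nth 0 (map (sym (cd_num C)) s) m.

Definition code_formula n (F : formula (param_language L (@cr_emb R L A)) n) :
    seq nat :=
  cd_rel C (f_rel F) ::
    [seq code_string (prefix_form (f_args i))
      | i <- enum 'I_(relsym_ar (f_rel F))].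

Definition code_system n (T : psystem A n) : seq nat :=
  size T :: flatten (map (@code_formula n) T).

Definition H10_positive : Prop :=
  exists f : seq nat -> bool,
    recursive_seq_bool f /\
    forall n (T : psystem A n),
      f (code_system T) = true <-> exists x : n.-tuple R, solution T x.

End Code.

(* The code of T does not record n, so the tuple of variables of T has to be
   read off from T: it is x_1, ..., x_n with n the largest index occurring. *)
Definition effective R1 R2 (L1 : language R1) (L2 : language R2)
    (A1 : compatible_ring L1) (A2 : compatible_ring L2)
    (C1 : coding A1) (C2 : coding A2) (d : R1 -> R2) : Prop :=
  exists D : seq nat -> seq nat,
    recursive_seq D /\
    forall n (T : psystem A1 n), exact_vars T ->
      exists (l : nat) (T' : psystem A2 (n + l)),
        [/\ D (code_system C1 T) = code_system C2 T',
            forall x : n.-tuple R1, solution T x ->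
              exists y : l.-tuple R2, solution T' (cat_tuple (map_tuple d x) y)
          & forall (z : n.-tuple R2) (y : l.-tuple R2),
              solution T' (cat_tuple z y) ->
              exists2 x : n.-tuple R1, solution T x & z = map_tuple d x].

(* Main.v *)
Require Import Defs.
From mathcomp Require Import all_boot.
From Stdlib Require List.
From Stdlib Require Import Classical.

Set Implicit Arguments.
Unset Strict Implicit.
Unset Printing Implicit Defensive.

(** If [f] decides solvability over [R2] from the code of a system and [D] is
the recursive function witnessing that [d] is effective, then [f \o D] decides
solvability over [R1]: a system [T] has a solution over [R1] iff the system coded
by [D (code T)] has one over [R2].

Effectiveness only speaks of systems in the variables x_1, ..., x_n where x_n
really occurs, whereas a decision procedure must treat every system written in n
variables. Since the code of a system does not record n, the trailing variables
that do not occur can be dropped without changing the code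
([code_drop_system]); solvability is unchanged because [R1] is inhabited by the
constant 0 ([solvable_drop_system]). This is [exact_vars_reduction]. *)

(** Since [CodeSeq.decode] is a left inverse of [CodeSeq.code], recursiveness
through the coding of sequences is stable under composition. *)
Lemma recursive_seq_bool_comp (f : seq nat -> bool) (D : seq nat -> seq nat) :
  recursive_seq_bool f -> recursive_seq D -> recursive_seq_bool (f \o D).
Proof.
move=> recf recD.
apply: recursive_ext (recursive_comp recf (fun _ : 'I_1 => recD)) _ => v.
by rewrite /= /thead tnth_mktuple CodeSeq.codeK.
Qed.

Section DropLastVariable.
Variables (R : Type) (L : language R) (n : nat).

(** Removal of the last variable from a term; the constant 0 is a default value
for the terms in which that variable occurs. *)
Fixpoint drop_term (t : term L n.+1) : term L n :=
  match t with
  | Var i => if unlift ord_max i is Some j then Var L j else Cst n (cst0 L)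
  | Cst c => Cst n c
  | Fn f args => Fn (fun k => drop_term (args k))
  end.

Definition drop_formula (F : formula L n.+1) : formula L n :=
  Formula (fun k => drop_term (@f_args R L n.+1 F k)).

Definition drop_system (T : system L n.+1) : system L n := map drop_formula T.

Lemma eval_drop_term (x : n.-tuple R) (x' : n.+1.-tuple R) (t : term L n.+1) :
  (forall j, tnth x' (lift ord_max j) = tnth x j) ->
  ~ occurs_term ord_max t -> eval x (drop_term t) = eval x' t.
Proof.
move=> xx'; elim: t => [i | c | f args IH] //= nocc.
  by case: unliftP => [j ->|/nocc] //=.
congr (fn_val _); apply: eq_from_tnth => k; rewrite !tnth_mktuple.
by apply: IH => occ; apply: nocc; exists k.
Qed.

Lemma solution_drop_system (x : n.-tuple R) (x' : n.+1.-tuple R)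
    (T : system L n.+1) :
  (forall j, tnth x' (lift ord_max j) = tnth x j) ->
  ~ occurs ord_max T -> solution (drop_system T) x <-> solution T x'.
Proof.
move=> xx' nocc; rewrite /solution.
elim: T nocc => [|F T IH] nocc; first by split=> _; apply: List.Forall_nil.
have holdsE : holds x (drop_formula F) <-> holds x' F.
  rewrite /holds /=.
  suff -> : [tuple eval x (drop_term (f_args k)) | k < relsym_ar (f_rel F)] =
            [tuple eval x' (f_args k) | k < relsym_ar (f_rel F)] by [].
  apply: eq_from_tnth => k; rewrite !tnth_mktuple.
  apply: (eval_drop_term xx') => occ.
  by apply: nocc; apply: List.Exists_cons_hd; exists k.
have {}IH := IH (fun occ => nocc (List.Exists_cons_tl _ occ)).
by rewrite /= !List.Forall_cons_iff holdsE IH.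
Qed.

Lemma solvable_drop_system (T : system L n.+1) :
  ~ occurs ord_max T ->
  (exists x, solution (drop_system T) x) <-> exists x, solution T x.
Proof.
move=> nocc; split=> [[x solx] | [x' solx']].
  pose x' := [tuple if unlift ord_max i is Some j then tnth x j
                    else cst_val (cst0 L) | i < n.+1].
  have xx' j : tnth x' (lift ord_max j) = tnth x j by rewrite tnth_mktuple liftK.
  by exists x'; apply: (proj1 (solution_drop_system xx' nocc)).
pose x := [tuple tnth x' (lift ord_max j) | j < n].
have xx' j : tnth x' (lift ord_max j) = tnth x j by rewrite tnth_mktuple.
by exists x; apply: (proj2 (solution_drop_system xx' nocc)).
Qed.

End DropLastVariable.

Section CodeDropLastVariable.
Variables (R : Type) (L : language R) (A : compatible_ring L) (C : coding A).

Lemma prefix_form_drop_term n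
    (t : term (param_language L (@cr_emb R L A)) n.+1) :
  ~ occurs_term ord_max t -> prefix_form (drop_term t) = prefix_form t.
Proof.
elim: t => [i | c | f args IH] //= nocc.
  by case: unliftP => [j ->|/nocc] //=; rewrite /bump leqNgt ltn_ord.
congr (_ :: flatten _); apply: eq_map => k.
by apply: IH => occ; apply: nocc; exists k.
Qed.

Lemma code_drop_system n (T : psystem A n.+1) :
  ~ occurs ord_max T ->
  code_system (A := A) C (drop_system T) = code_system C T.
Proof.
rewrite /code_system size_map => nocc; congr (_ :: flatten _).
elim: T nocc => [|F T IH] nocc //=.
rewrite IH => [|occ]; last by apply: nocc; apply: List.Exists_cons_tl.
congr (_ :: _); congr (_ :: _); apply: eq_map => k.
rewrite prefix_form_drop_term // => occ.
by apply: nocc; apply: List.Exists_cons_hd; exists k.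
Qed.

Lemma exact_vars_reduction n (T : psystem A n) :
  exists m (T0 : psystem A m),
    [/\ exact_vars T0, code_system C T0 = code_system C T
      & (exists x, solution T0 x) <-> exists x, solution T x].
Proof.
elim: n T => [|n IH] T; first by exists 0, T; split=> // -[].
case: (classic (occurs ord_max T)) => [occ | nocc].
  exists n.+1, T; split=> // i [i_n].
  by have -> : i = ord_max by apply: val_inj.
have [m [T0 [exT0 codeT0 solT0]]] := IH (drop_system T).
exists m, T0; split=> //; first by rewrite codeT0 code_drop_system.
by rewrite solT0; exact: solvable_drop_system.
Qed.

End CodeDropLastVariable.

Theorem theorem1p9 (R1 R2 : Type) (L1 : language R1) (L2 : language R2)
    (countL1 : countable_language L1) (countL2 : countable_language L2)
    (existsL1 : H10_exists L1) (existsL2 : H10_exists L2)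
    (A1 : compatible_ring L1) (A2 : compatible_ring L2)
    (C1 : coding A1) (C2 : coding A2) (d : R1 -> R2) :
  H10_positive C2 ->
  diophantine_map L1 L2 d ->
  effective C1 C2 d ->
  H10_positive C1.
Proof.
move=> [f [recf fP]] _ [D [recD DP]].
exists (f \o D); split; first exact: recursive_seq_bool_comp.
move=> n T; have [m [T0 [exT0 <- <-]]] := exact_vars_reduction C1 T.
have [l [T' [/= -> T0T' T'T0]]] := DP _ _ exT0.
rewrite fP; split=> [[w] | [x /T0T'[y soly]]]; last by eexists; exact: soly.
(* A solution of T' splits into the coordinates z = d(x) and the auxiliary y. *)
have -> : w = cat_tuple [tuple tnth w (lshift l i) | i < m]
                        [tuple tnth w (rshift m j) | j < l].
  apply: eq_from_tnth => k; rewrite -(splitK k).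
  by case: (split k) => i /=; rewrite ?tnth_lshift ?tnth_rshift tnth_mktuple.
by move=> /T'T0[x solx _]; exists x.
Qed.
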